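(* Let $a,b,c>0$ be real and let $F(x)=F(a,b;c;x)$ for $0<x<1$. For $0<x,y<1$ let $$Q_F(x,y)=\frac{F(a,b;c;x)+F(a,b;c;y)}{F(a,b;c;x+y-xy)}.$$ Then for all $0<x,y<1$, $$0<Q_F(x,y)\le 2.$$
   Context: $F(a,b;c;x)=\sum_{n=0}^{\infty}\frac{(a,n)(b,n)}{(c,n)}\frac{x^n}{n!}$ for $|x|<1$ is the Gaussian hypergeometric function, where $(a,0)=1$ and $(a,n)=a(a+1)\cdots(a+n-1)$ for $n\ge 1$. Note that $x+y-xy\in(0,1)$ for $x,y\in(0,1)$. *)

(* Defs.v *)
From Stdlib Require Import Reals Factorial.
From Coquelicot Require Import Coquelicot.
Open Scope R_scope.

Fixpoint pochhammer (a : R) (n : nat) : R :=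
  match n with
  | O => 1
  | S m => pochhammer a m * (a + INR m)
  end.

(** [PSeries] is total; [hyp2F1 a b c x] is only meant for [Rabs x < 1]
    and [c] not a nonpositive integer, where the series converges. *)
Definition hyp2F1 (a b c x : R) : R :=
  PSeries (fun n => pochhammer a n * pochhammer b n / pochhammer c n
                    / INR (fact n)) x.

Definition Q_F (a b c x y : R) : R :=
  (hyp2F1 a b c x + hyp2F1 a b c y) / hyp2F1 a b c (x + y - x * y).

(* Main.v *)
(** The series has positive coefficients whose consecutive ratios tend to [1],
    so it converges on [[0, 1)] and is nondecreasing there with value [1] at
    [0].  Since [x + y - x y] is at least [x] and [y], each of [F x], [F y] is
    at most [F (x + y - x y)]. *)
Require Import Defs.
From Stdlib Require Import Reals Factorial Lra.
From Coquelicot Require Import Coquelicot.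
Open Scope R_scope.

Lemma pochhammer_gt0 (a : R) (n : nat) : 0 < a -> 0 < pochhammer a n.
Proof.
intros ha; induction n as [|n IH]; simpl; [lra|].
apply Rmult_lt_0_compat; [assumption|].
pose proof (pos_INR n); lra.
Qed.

Definition hyp2F1_coef (a b c : R) (n : nat) : R :=
  pochhammer a n * pochhammer b n / pochhammer c n / INR (fact n).

Lemma hyp2F1_coef_gt0 (a b c : R) (n : nat) :
  0 < a -> 0 < b -> 0 < c -> 0 < hyp2F1_coef a b c n.
Proof.
intros ha hb hc; unfold hyp2F1_coef.
repeat apply Rdiv_lt_0_compat; try apply Rmult_lt_0_compat;
  auto using pochhammer_gt0, INR_fact_lt_0.
Qed.

(** The ratio equals [1 + (p - q) / (q + n)], and [q + n] tends to infinity. *)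
Lemma is_lim_seq_shift_ratio (p q : R) :
  0 < q -> is_lim_seq (fun n => (p + INR n) / (q + INR n)) 1.
Proof.
intros hq.
apply is_lim_seq_ext with (fun n => 1 + (p - q) * / (q + INR n)).
  intros n; pose proof (pos_INR n); field; lra.
replace (Finite 1) with (Finite (1 + (p - q) * 0)) by (f_equal; ring).
apply is_lim_seq_plus'; [apply is_lim_seq_const|].
apply (is_lim_seq_scal_l _ (p - q) 0).
apply (is_lim_seq_inv _ p_infty); [|discriminate].
apply (is_lim_seq_plus _ _ q p_infty);
  [apply is_lim_seq_const | apply is_lim_seq_INR | reflexivity].
Qed.

(** By d'Alembert's criterion: consecutive coefficients have ratio
    [(a + n)(b + n) / ((c + n)(1 + n))], a product of two shift ratios, where [1 + n] comes from the
    factorial. *)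
Lemma CV_radius_hyp2F1 (a b c : R) :
  0 < a -> 0 < b -> 0 < c -> CV_radius (hyp2F1_coef a b c) = 1.
Proof.
intros ha hb hc.
(* The criterion yields the radius as the inverse of the limit ratio. *)
rewrite <- Rinv_1.
apply CV_radius_finite_DAlembert; [|lra|].
  intros n; apply Rgt_not_eq, hyp2F1_coef_gt0; assumption.
apply is_lim_seq_ext with
  (fun n => (a + INR n) / (c + INR n) * ((b + INR n) / (1 + INR n))).
- intros n.
  rewrite Rabs_pos_eq.
  2: now apply Rlt_le, Rdiv_lt_0_compat; apply hyp2F1_coef_gt0.
  unfold hyp2F1_coef; rewrite fact_simpl, mult_INR, S_INR; simpl pochhammer.
  pose proof (pos_INR n).
  pose proof (pochhammer_gt0 a n ha); pose proof (pochhammer_gt0 b n hb).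
  pose proof (pochhammer_gt0 c n hc); pose proof (INR_fact_lt_0 n).
  field; repeat split; lra.
- replace (Finite 1) with (Finite (1 * 1)) by (f_equal; ring).
  apply is_lim_seq_mult'; apply is_lim_seq_shift_ratio; lra.
Qed.

(** The comparison is termwise; only the larger series, at [y], has to be shown convergent, and [y]
    lies inside the unit radius. *)
Lemma hyp2F1_le (a b c x y : R) :
  0 < a -> 0 < b -> 0 < c -> 0 <= x <= y -> y < 1 ->
  hyp2F1 a b c x <= hyp2F1 a b c y.
Proof.
intros ha hb hc [hx hxy] hy.
apply Series_le.
- intros n; fold (hyp2F1_coef a b c n).
  pose proof (hyp2F1_coef_gt0 a b c n ha hb hc) as hn.
  split.
  + now apply Rmult_le_pos; [lra | apply pow_le].
  + now apply Rmult_le_compat_l; [lra | apply pow_incr].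
- apply ex_pseries_R, (CV_radius_inside (hyp2F1_coef a b c)).
  rewrite CV_radius_hyp2F1 by assumption; simpl.
  rewrite Rabs_pos_eq; lra.
Qed.

Lemma hyp2F1_0 (a b c : R) : hyp2F1 a b c 0 = 1.
Proof. unfold hyp2F1; rewrite PSeries_0; simpl; field. Qed.

Theorem theorem1p1 (a b c : R) (ha : 0 < a) (hb : 0 < b) (hc : 0 < c) :
  forall x y : R, 0 < x < 1 -> 0 < y < 1 ->
    0 < Q_F a b c x y <= 2.
Proof.
intros x y hx hy.
(* With [z = x + y - x * y]: [z - x = y (1 - x)], [z - y = x (1 - y)] and
   [1 - z = (1 - x)(1 - y)]. *)
assert (hxz : x <= x + y - x * y) by nra.
assert (hyz : y <= x + y - x * y) by nra.
assert (hz1 : x + y - x * y < 1) by nra.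
unfold Q_F; set (z := x + y - x * y) in *.
(* Comparison with the value at [0] makes the numerator positive and, through [hFx], the denominator
   too. *)
assert (h0x : 1 <= hyp2F1 a b c x).
  rewrite <- (hyp2F1_0 a b c); apply hyp2F1_le; lra.
assert (h0y : 1 <= hyp2F1 a b c y).
  rewrite <- (hyp2F1_0 a b c); apply hyp2F1_le; lra.
assert (hFx : hyp2F1 a b c x <= hyp2F1 a b c z) by (apply hyp2F1_le; lra).
assert (hFy : hyp2F1 a b c y <= hyp2F1 a b c z) by (apply hyp2F1_le; lra).
split.
- apply Rdiv_lt_0_compat; lra.
- apply Rle_div_l; lra.
Qed.
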